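(* Let $s\in\mathbb C$. The $\mathbb C$-linear map $\widehat\phi_s:\widehat{\mathcal{SD}}\to\widehat{\mathrm{gl}}_{\infty|\infty}$ defined by $$\widehat\phi_s|_{\widehat{\mathcal{SD}}_j}=\phi_s|_{\widehat{\mathcal{SD}}_j}\quad(j\ne0),$$ $$\widehat\phi_s(e^{xD}\partial_\theta\theta)=\phi_s(e^{xD}\partial_\theta\theta)-\frac{e^{sx}-1}{e^x-1}\,\mathbf 1,\qquad \widehat\phi_s(e^{xD}\theta\partial_\theta)=\phi_s(e^{xD}\theta\partial_\theta)+\frac{e^{sx}-1}{e^x-1}\,\mathbf 1,$$ $$\widehat\phi_s(C)=\mathbf 1$$ (identities of formal power series in $x$, read coefficientwise) is a homomorphism of Lie superalgebras.
   Context: $\mathcal{SD}$ is the Lie superalgebra (supercommutator bracket) of the associative superalgebra over $\mathbb C$ generated by even $t^{\pm1}$, $D=t\frac{d}{dt}$ and odd $\theta,\partial_\theta$, with $f(D)t=tf(D+1)$, $\theta^2=\partial_\theta^2=0$, $\theta\partial_\theta+\partial_\theta\theta=1$, $\theta,\partial_\theta$ commuting with $t,D$. Put $M_0=\partial_\theta\theta$, $M_1=\theta\partial_\theta$, $M_+=\partial_\theta$, $M_-=\theta$, and $F(D)=\sum_{a=0,1,\pm}f_a(D)M_a$, $f_a\in\mathbb C[w]$ (similarly $G$). $\widehat{\mathcal{SD}}=\mathcal{SD}\oplus\mathbb CC$, $C$ central, is the central extension by the 2-cocycle $\Psi$ with $\Psi(t^rF(D),t^{r'}G(D))=0$ if $r+r'\ne0$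 and, for $r=-r'\ge0$, $$\Psi(t^rF(D),t^{r'}G(D))=\sum_{-r\le j\le-1}\big(f_0(j)g_0(j+r)+f_+(j)g_-(j+r)-f_-(j)g_+(j+r)-f_1(j)g_1(j+r)\big),$$ extended to $r<0$ by super skew-symmetry. Principal $\frac12\mathbb Z$-gradation: $wt(C)=wt(D)=0$, $wt(t)=1$, $wt(\theta)=\frac12$, $wt(\partial_\theta)=-\frac12$; the degree-$0$ part is spanned by $C$ and $D^n\partial_\theta\theta$, $D^n\theta\partial_\theta$ ($n\ge0$). $\mathrm{gl}_{\infty|\infty}$ is the Lie superalgebra of matrices $(a_{ij})_{i,j\in\frac12\mathbb Z}$ with $a_{ij}=0$ for $|i-j|\gg0$, with $E_{ij}$ even if $i-j\in\mathbb Z$ and odd if $i-j\in\frac12+\mathbb Z$. $\widehat{\mathrm{gl}}_{\infty|\infty}=\mathrm{gl}_{\infty|\infty}\oplus\mathbb C\mathbf 1$, with $\mathbf 1$ central, is its central extension by the 2-cocycle $\alpha(A,B)=\mathrm{Str}([J,A]B)$, $J=\sum_{r\le0}E_{rr}$ ($r\in\frac12\mathbb Z$), $\mathrm{Str}(c_{ij})=\sum_{r\in\frac12\mathbb Z}(-1)^{2r}c_{rr}$. For $i,j\in\mathbb Z$ write $E_{ij}M_0=E_{ij}$, $E_{ij}M_1=E_{i-\frac12,j-\frac12}$, $E_{ij}M_+=E_{i,j-\frac12}$, $E_{ij}M_-=E_{i-\frac12,j}$. The embedding $\phi_s:\mathcal{SD}\to\mathrm{gl}_{\infty|\infty}$ is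 the linear map $\phi_s(t^kf(D)M_a)=\sum_{j\in\mathbb Z}f(-j+s)E_{j-k,j}M_a$, $a\in\{0,1,+,-\}$. *)

(* Defs.v *)
From HB Require Import structures.
From mathcomp Require Import all_boot all_order all_algebra zify.
From mathcomp Require Import boolp classical_sets functions cardinality fsbigop reals.
From mathcomp Require Import complex.

Set Implicit Arguments.
Unset Strict Implicit.
Unset Printing Implicit Defensive.

Import Order.TTheory GRing.Theory Num.Theory.
Local Open Scope ring_scope.

Definition zball (N : nat) : seq int :=
  [seq k%:Z - N%:Z | k <- iota 0 N.*2.+1].

Lemma mem_zball N (k : int) : (k \in zball N) = (`|k| <= N)%N.
Proof.
apply/mapP/idP => [[m]|kN]; first by rewrite mem_iota => m2 ->; lia.
by exists `|(k + N%:Z)%R|%N; rewrite ?mem_iota; lia.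
Qed.

Lemma zball_uniq N : uniq (zball N).
Proof. by rewrite map_inj_uniq ?iota_uniq// => a b; lia. Qed.

Lemma fsumZ (V : nmodType) (F : int -> V) N :
  (forall k, (N < `|k|)%N -> F k = 0) ->
  \sum_(k \in [set: int]) F k = \sum_(k <- zball N) F k.
Proof.
move=> F0; rewrite [RHS]fsbig_seq ?zball_uniq//; 
apply/esym; apply: (@fsbig_widen _ _ 0 _ [set` zball N] setT) => // k /=.
by move=> [_ /negP]; rewrite mem_zball -ltnNge => /F0.
Qed.

Lemma fsumZ1 (V : nmodType) (F : int -> V) k0 :
  (forall k, k != k0 -> F k = 0) -> \sum_(k \in [set: int]) F k = F k0.
Proof.
move=> F0; transitivity (\sum_(k \in [set k0]) F k); last exact: fsbig_set1.
apply/esym; apply: (@fsbig_widen _ _ 0 _ [set k0] setT) => // k /= [_].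
by move=> /eqP /F0.
Qed.

(* The associative superalgebra SD.  Its elements are the finite sums         *)
(* sum_k t^k F_k(D), F_k = sum_a f_{k,a}(D) M_a.  An index a is a pair of     *)
(* booleans (p, q): M_(p,q) maps the part of theta-degree q of C[theta] to    *)
(* the part of theta-degree p, so that M_(p,q) M_(q',r) = [q = q'] M_(p,r).   *)

Notation mindex := (bool * bool)%type.
Definition M0 : mindex := (false, false). (* d/dtheta theta *)
Definition M1 : mindex := (true, true).   (* theta d/dtheta *)
Definition Mp : mindex := (false, true).  (* d/dtheta       *)
Definition Mm : mindex := (true, false).  (* theta          *)

Definition SD_support (K : fieldType) : {pred int -> mindex -> {poly K}} :=
  fun x => `[< exists N : nat, forall k : int, (N < `|k|)%N -> x k = 0 >].

Record SD (K : fieldType) := MkSD {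
  SD_val :> int -> mindex -> {poly K};
  SD_valP : SD_val \in @SD_support K }.

HB.instance Definition _ (K : fieldType) := [isSub for @SD_val K].
HB.instance Definition _ (K : fieldType) := [Choice of SD K by <:].

Lemma SD_bound K (x : SD K) :
  exists N : nat, forall k : int, (N < `|k|)%N -> x k = 0.
Proof. by have /asboolP := SD_valP x. Qed.

Fact SD_support_closed K : submod_closed (@SD_support K).
Proof.
split; first by apply/asboolP; exists 0%N.
move=> c x y /asboolP[N xN] /asboolP[M yM]; apply/asboolP; exists (maxn N M) => k.
rewrite gtn_max => /andP[kN kM].
by transitivity (c *: x k + y k) => [//|]; rewrite xN ?yM// scaler0 addr0.
Qed.
HB.instance Definition _ (K : fieldType) :=
  GRing.isSubmodClosed.Build _ _ (@SD_support K) (@SD_support_closed K).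
HB.instance Definition _ (K : fieldType) := [SubChoice_isSubLmodule of SD K by <:].

Lemma SDP K (x y : SD K) : (forall k a, x k a = y k a) -> x = y.
Proof. by move=> xy; apply/val_inj/funext => k; apply/funext => a; apply: xy. Qed.

Lemma SDDE K (x y : SD K) k a : (x + y) k a = x k a + y k a.
Proof. by []. Qed.
Lemma SDZE K c (x : SD K) k a : (c *: x) k a = c *: x k a.
Proof. by []. Qed.

(* f(D) t^l = t^l f(D + l) *)
Definition shiftp (K : fieldType) (l : int) (f : {poly K}) : {poly K} :=
  f \Po ('X + (l%:~R)%:P).

Lemma shiftpD (K : fieldType) l (f g : {poly K}) :
  shiftp l (f + g) = shiftp l f + shiftp l g.
Proof. exact: comp_polyD. Qed.
Lemma shiftpM (K : fieldType) l (f g : {poly K}) :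
  shiftp l (f * g) = shiftp l f * shiftp l g.
Proof. exact: comp_polyM. Qed.
Lemma shiftpZ (K : fieldType) l c (f : {poly K}) :
  shiftp l (c *: f) = c *: shiftp l f.
Proof. exact: comp_polyZ. Qed.
Lemma shiftp0 (K : fieldType) l : shiftp l (0 : {poly K}) = 0.
Proof. exact: comp_poly0. Qed.
Lemma shiftp1 (K : fieldType) l : shiftp l (1 : {poly K}) = 1.
Proof. by rewrite /shiftp -polyC1 comp_polyC. Qed.
Lemma shiftpX (K : fieldType) l : shiftp l ('X : {poly K}) = 'X + (l%:~R)%:P.
Proof. exact: comp_polyX. Qed.
Lemma shiftp0z (K : fieldType) (f : {poly K}) : shiftp 0 f = f.
Proof. by rewrite /shiftp addr0 comp_polyXr. Qed.
Lemma shiftp_shiftp (K : fieldType) l m (f : {poly K}) :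
  shiftp l (shiftp m f) = shiftp (l + m) f.
Proof.
rewrite /shiftp -comp_polyA comp_polyD comp_polyX comp_polyC.
by rewrite -addrA -polyCD -intrD.
Qed.
Lemma shiftp_sum (K : fieldType) l (I : Type) (s : seq I) (F : I -> {poly K}) :
  shiftp l (\sum_(i <- s) F i) = \sum_(i <- s) shiftp l (F i).
Proof. exact: raddf_sum. Qed.

(* t^k F(D) t^(n-k) G(D) = t^n F(D + (n-k)) G(D) *)
Definition SD_mul_fun (K : fieldType) (x y : int -> mindex -> {poly K}) :
    int -> mindex -> {poly K} := fun n a =>
  \sum_(k \in [set: int]) \sum_(b : bool)
     shiftp (n - k) (x k (a.1, b)) * y (n - k) (b, a.2).

Fact SD_mul_subproof K (x y : SD K) : SD_mul_fun x y \in @SD_support K.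
Proof.
have [N xN] := SD_bound x; have [M yM] := SD_bound y.
apply/asboolP; exists (N + M)%N => n nNM; apply/funext => a.
apply: fsbig1 => k _; rewrite big1// => b _.
have [kN|kN] := ltnP N `|k|%N; first by rewrite xN// shiftp0 mul0r.
by rewrite yM ?mulr0//; lia.
Qed.
Definition SD_mul K (x y : SD K) : SD K := MkSD (SD_mul_subproof x y).

Fact SD_mono_subproof (K : fieldType) (k : int) (F : mindex -> {poly K}) :
  (fun n => if n == k then F else 0) \in @SD_support K.
Proof.
by apply/asboolP; exists `|k|%N => n nk; case: eqP => // E; move: nk; rewrite E ltnn.
Qed.
(* t^k F(D) *)
Definition SD_mono (K : fieldType) (k : int) (F : mindex -> {poly K}) : SD K :=
  MkSD (SD_mono_subproof k F).

Definition SD_one (K : fieldType) : SD K :=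
  SD_mono 0 (fun a : mindex => (a.1 == a.2)%:R).

Section SDring.
Variable K : fieldType.
Implicit Types x y z : SD K.

Lemma SD_mulE x y N n a : (forall k : int, (N < `|k|)%N -> x k = 0) ->
  SD_mul x y n a = \sum_(k <- zball N) \sum_(b : bool)
     shiftp (n - k) (x k (a.1, b)) * y (n - k) (b, a.2).
Proof.
by move=> xN; apply: fsumZ => k kN; rewrite big1// => b _; rewrite xN// shiftp0 mul0r.
Qed.

Fact SD_mulDl : left_distributive (@SD_mul K) +%R.
Proof.
move=> x y z; have [N xN] := SD_bound x; have [M yM] := SD_bound y.
have xNM k : (maxn N M < `|k|)%N -> x k = 0 by move=> kNM; apply: xN; lia.
have yNM k : (maxn N M < `|k|)%N -> y k = 0 by move=> kNM; apply: yM; lia.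
have xyNM k : (maxn N M < `|k|)%N -> (x + y) k = 0.
  by move=> kNM; transitivity (x k + y k) => [//|]; rewrite xNM ?yNM ?addr0.
apply: SDP => n a; rewrite SDDE (SD_mulE _ _ _ xNM) (SD_mulE _ _ _ yNM) (SD_mulE _ _ _ xyNM).
rewrite -big_split; apply: eq_bigr => k _ /=; rewrite -big_split; apply: eq_bigr => b _ /=.
by rewrite shiftpD mulrDl.
Qed.

Fact SD_mulDr : right_distributive (@SD_mul K) +%R.
Proof.
move=> x y z; have [N xN] := SD_bound x.
apply: SDP => n a; rewrite SDDE !(SD_mulE _ _ _ xN) -big_split.
apply: eq_bigr => k _ /=; rewrite -big_split; apply: eq_bigr => b _ /=.
by rewrite -mulrDr.
Qed.

Fact SD_mul1 : left_id (SD_one K) (@SD_mul K).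
Proof.
move=> x; apply: SDP => n [a c]; rewrite /= /SD_mul_fun (fsumZ1 (k0 := 0)) /=.
  by rewrite subr0 (bigD1 a)//= big1 ?addr0 ?eqxx ?shiftp1 ?mul1r// => b /negPf;
     rewrite eq_sym => ->; rewrite shiftp0 mul0r.
by move=> k /negPf->; rewrite big1// => b _; rewrite shiftp0 mul0r.
Qed.

Fact SD_mulr1 : right_id (SD_one K) (@SD_mul K).
Proof.
move=> x; apply: SDP => n [a c]; rewrite /= /SD_mul_fun (fsumZ1 (k0 := n)) /=.
  rewrite subrr eqxx (bigD1 c)//= big1 ?addr0 ?eqxx ?shiftp0z ?mulr1// => b /negPf ->.
  by rewrite mulr0.
move=> k kn; rewrite ifF ?big1// => [b _|]; last by lia.
by rewrite mulr0.
Qed.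

Fact SD_mulA : associative (@SD_mul K).
Proof.
move=> x y z; apply: SDP => n a.
have [N xN] := SD_bound x; have [M yM] := SD_bound y.
have xyNM k : (N + M < `|k|)%N -> SD_mul x y k = 0.
  move=> kNM; apply/funext => b; rewrite (SD_mulE _ _ _ xN) big_seq big1// => l.
  by rewrite mem_zball => lN; rewrite big1// => c _; rewrite yM ?mulr0//; lia.
rewrite (SD_mulE _ _ _ xN) (SD_mulE _ _ _ xyNM).
under [RHS]eq_bigr => m _.
  under eq_bigr => b _ do
    rewrite (SD_mulE _ _ _ xN) shiftp_sum big_distrl /=.
  rewrite exchange_big /=; over.
rewrite [RHS]exchange_big /= [LHS]big_seq [RHS]big_seq; apply: eq_bigr => k.
rewrite mem_zball => kN.
under [RHS]eq_bigr => m _.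
  under eq_bigr => b _ do rewrite /shiftp raddf_sum big_distrl /= -/(shiftp _ _).
  rewrite exchange_big /=; over.
rewrite [RHS]exchange_big /=; apply: eq_bigr => b _.
have -> : SD_mul_fun y z (n - k) (b, a.2) =
  \sum_(m <- zball (N + M)) \sum_(c : bool)
   shiftp (n - m) (y (m - k) (b, c)) * z (n - m) (c, a.2).
  rewrite /SD_mul_fun (reindex_fsbigT (fun m => m - k)) /=; last first.
    by exists (fun m => m + k) => m; rewrite ?subrK ?addrK.
  rewrite (fsumZ (N := N + M)) => [|m mNM]; last first.
    by rewrite big1// => c _; rewrite yM ?shiftp0 ?mul0r//; lia.
  apply: eq_bigr => m _; apply: eq_bigr => c _.
  by have -> : n - k - (m - k) = n - m by lia.
rewrite big_distrr /=; apply: eq_bigr => m _; rewrite big_distrr /=.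
apply: eq_bigr => c _; rewrite -/(shiftp _ _) shiftpM shiftp_shiftp mulrA.
by congr (shiftp _ _ * _ * _); lia.
Qed.

Fact SD_one_neq0 : SD_one K != 0.
Proof.
apply/eqP => /(congr1 (fun x : SD K => x 0 M0)) /= /eqP.
by rewrite oner_eq0.
Qed.
End SDring.

HB.instance Definition _ (K : fieldType) := GRing.Zmodule_isNzRing.Build (SD K)
  (@SD_mulA K) (@SD_mul1 K) (@SD_mulr1 K) (@SD_mulDl K) (@SD_mulDr K) (@SD_one_neq0 K).

Fact SD_scalerAl (K : fieldType) (c : K) (x y : SD K) : c *: (x * y) = c *: x * y.
Proof.
have [N xN] := SD_bound x; apply: SDP => n a.
have cxN k : (N < `|k|)%N -> (c *: x) k = 0.
  by move=> kN; transitivity (c *: x k) => [//|]; rewrite xN// scaler0.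
rewrite SDZE (SD_mulE _ _ _ xN) (SD_mulE _ _ _ cxN) scaler_sumr.
apply: eq_bigr => k _; rewrite scaler_sumr; apply: eq_bigr => b _.
by rewrite SDZE shiftpZ scalerAl.
Qed.
HB.instance Definition _ (K : fieldType) :=
  GRing.Lmodule_isLalgebra.Build K (SD K) (@SD_scalerAl K).

Fact SD_scalerAr (K : fieldType) (c : K) (x y : SD K) : c *: (x * y) = x * (c *: y).
Proof.
have [N xN] := SD_bound x; apply: SDP => n a.
rewrite SDZE !(SD_mulE _ _ _ xN) scaler_sumr.
apply: eq_bigr => k _; rewrite scaler_sumr; apply: eq_bigr => b _.
by rewrite SDZE scalerAr.
Qed.
HB.instance Definition _ (K : fieldType) :=
  GRing.Lalgebra_isAlgebra.Build K (SD K) (@SD_scalerAr K).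


(* The lemmas up to SD_dtheta_D are the defining relations; by SD_horner,     *)
(* SD_monoE and SD_sum_mono the elements below generate SD.                   *)
Definition SD_t (K : fieldType) (k : int) : SD K :=
  SD_mono k (fun a : mindex => (a.1 == a.2)%:R).
Definition SD_D (K : fieldType) : SD K :=
  SD_mono 0 (fun a : mindex => if a.1 == a.2 then 'X else 0).
Definition SD_theta (K : fieldType) : SD K :=
  SD_mono 0 (fun a : mindex => (a == Mm)%:R).
Definition SD_dtheta (K : fieldType) : SD K :=
  SD_mono 0 (fun a : mindex => (a == Mp)%:R).


Section Presentation.
Variable K : fieldType.
Local Notation theta := (SD_theta K).
Local Notation dtheta := (SD_dtheta K).
Local Notation D := (SD_D K).
Local Notation t := (@SD_t K).

Lemma SD_mono_mul (k l : int) (F G : mindex -> {poly K}) :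
  SD_mono k F * SD_mono l G =
  SD_mono (k + l) (fun a => \sum_(b : bool) shiftp l (F (a.1, b)) * G (b, a.2)).
Proof.
apply: SDP => n a; rewrite /= /SD_mul_fun (fsumZ1 (k0 := k)) => [|j /negPf jk].
  rewrite eqxx (_ : (n - k == l) = (n == k + l)); last by lia.
  case: (eqVneq n (k + l)) => [->|nkl]; last by rewrite big1// => b _; rewrite mulr0.
  by apply: eq_bigr => b _; rewrite addrAC subrr add0r.
by rewrite jk big1// => b _; rewrite shiftp0 mul0r.
Qed.

Lemma SD_mono_add (k : int) (F G : mindex -> {poly K}) :
  SD_mono k F + SD_mono k G = SD_mono k (fun a => F a + G a).
Proof. by apply: SDP => n a; rewrite SDDE /=; case: eqP => // _; rewrite addr0. Qed.

Lemma SD_mono_scale (k : int) c (F : mindex -> {poly K}) :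
  c *: SD_mono k F = SD_mono k (fun a => c *: F a).
Proof. by apply: SDP => n a; rewrite SDZE /=; case: eqP => // _; rewrite scaler0. Qed.

Lemma SD_mono0 (k : int) : SD_mono k (fun _ => 0 : {poly K}) = 0.
Proof. by apply: SDP => n a; rewrite /= if_same. Qed.

Lemma eq_SD_mono k (F G : mindex -> {poly K}) : F =1 G -> SD_mono k F = SD_mono k G.
Proof. by move=> FG; congr SD_mono; apply/funext. Qed.

Let simp := (@shiftpX K, @shiftp1 K, @shiftp0 K, @mul0r {poly K}, @mulr0 {poly K},
  @mul1r {poly K}, @mulr1 {poly K}, @addr0 {poly K}, @add0r {poly K}).

Lemma SD_oneE : 1 = SD_mono 0 (fun a : mindex => (a.1 == a.2)%:R) :> SD K.
Proof. by []. Qed.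

Lemma SD_t0 : t 0 = 1. Proof. by []. Qed.

Lemma SD_tD k l : t (k + l) = t k * t l.
Proof.
by rewrite SD_mono_mul; apply: eq_SD_mono => -[[] []]; rewrite /= big_bool /= !simp.
Qed.

Lemma SD_D_t : D * t 1 = t 1 * (D + 1).
Proof.
rewrite SD_oneE SD_mono_add !SD_mono_mul addrC; apply: eq_SD_mono => -[[] []];
by rewrite /= !big_bool /= !simp.
Qed.

Lemma SD_theta2 : theta * theta = 0.
Proof.
rewrite SD_mono_mul -(SD_mono0 (0 + 0)); apply: eq_SD_mono => -[[] []];
by rewrite /= big_bool /= !simp.
Qed.

Lemma SD_dtheta2 : dtheta * dtheta = 0.
Proof.
rewrite SD_mono_mul -(SD_mono0 (0 + 0)); apply: eq_SD_mono => -[[] []];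
by rewrite /= big_bool /= !simp.
Qed.

Lemma SD_theta_dtheta : theta * dtheta + dtheta * theta = 1.
Proof.
rewrite SD_oneE !SD_mono_mul SD_mono_add; apply: eq_SD_mono => -[[] []];
by rewrite /= !big_bool /= !simp.
Qed.

Lemma SD_theta_t k : theta * t k = t k * theta.
Proof.
rewrite !SD_mono_mul addrC; apply: eq_SD_mono => -[[] []];
by rewrite /= !big_bool /= !simp.
Qed.

Lemma SD_dtheta_t k : dtheta * t k = t k * dtheta.
Proof.
rewrite !SD_mono_mul addrC; apply: eq_SD_mono => -[[] []];
by rewrite /= !big_bool /= !simp.
Qed.

Lemma SD_theta_D : theta * D = D * theta.
Proof.
rewrite !SD_mono_mul; apply: eq_SD_mono => -[[] []];
by rewrite /= !big_bool /= ?shiftp0z !simp.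
Qed.

Lemma SD_dtheta_D : dtheta * D = D * dtheta.
Proof.
rewrite !SD_mono_mul; apply: eq_SD_mono => -[[] []];
by rewrite /= !big_bool /= ?shiftp0z !simp.
Qed.

Lemma SD_horner (f : {poly K}) :
  horner_alg D f = SD_mono 0 (fun a : mindex => if a.1 == a.2 then f else 0).
Proof.
elim/poly_ind: f => [|f c IH].
  by rewrite rmorph0 -(SD_mono0 0); apply: eq_SD_mono => a; rewrite if_same.
rewrite rmorphD rmorphM /= horner_algX horner_algC IH SD_mono_mul SD_oneE SD_mono_scale.
rewrite SD_mono_add; apply: eq_SD_mono => -[[] []];
by rewrite /= !big_bool /= ?shiftp0z !simp ?scaler0 ?addr0 ?alg_polyC.
Qed.

Lemma SD_monoE (k : int) (F : mindex -> {poly K}) :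
  SD_mono k F = t k * (horner_alg D (F M0) * (dtheta * theta)
                     + horner_alg D (F M1) * (theta * dtheta)
                     + horner_alg D (F Mp) * dtheta
                     + horner_alg D (F Mm) * theta).
Proof.
rewrite !SD_horner !SD_mono_mul !SD_mono_add SD_mono_mul.
rewrite (_ : k + (0 + (0 + 0)) = k); last by lia.
by apply: eq_SD_mono => -[[] []]; rewrite /= !big_bool /= ?shiftp0z !simp.
Qed.

Lemma SD_sum_mono (x : SD K) :
  exists s : seq int, x = \sum_(k <- s) SD_mono k (x k).
Proof.
have [N xN] := SD_bound x; exists (zball N); apply: SDP => n a.
have -> : (\sum_(k <- zball N) SD_mono k (x k)) n a =
          \sum_(k <- zball N) SD_mono k (x k) n a.
  by elim/big_ind2: _ => // x1 y1 x2 y2 <- <-.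
rewrite -(fsumZ (N := N)) => [|k kN]; last by rewrite /= xN// if_same.
by rewrite (fsumZ1 (k0 := n)) => [|k /negPf kn]; rewrite /= ?eqxx// eq_sym kn.
Qed.
End Presentation.

(* gl_{oo|oo}.  Indices in (1/2)Z are doubled: A u v is the entry of A at     *)
(* (u/2, v/2).                                                                *)

Definition gl_band (K : fieldType) : {pred int -> int -> K^o} :=
  fun A => `[< exists N : nat, forall u v : int, (N < `|u - v|)%N -> A u v = 0 >].

Record gl (K : fieldType) := MkGl {
  gl_val :> int -> int -> K^o;
  gl_valP : gl_val \in @gl_band K }.

HB.instance Definition _ K := [isSub for @gl_val K].
HB.instance Definition _ K := [Choice of gl K by <:].

Lemma gl_bound (K : fieldType) (A : gl K) :
  exists N : nat, forall u v : int, (N < `|u - v|)%N -> A u v = 0.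
Proof. by have /asboolP := gl_valP A. Qed.

Fact gl_band_closed (K : fieldType) : submod_closed (@gl_band K).
Proof.
split; first by apply/asboolP; exists 0%N.
move=> c A B /asboolP[N AN] /asboolP[M BM]; apply/asboolP.
exists (maxn N M) => u v; rewrite gtn_max => /andP[uvN uvM].
by transitivity (c *: A u v + B u v) => [//|]; rewrite AN ?BM// scaler0 addr0.
Qed.
HB.instance Definition _ (K : fieldType) :=
  GRing.isSubmodClosed.Build _ _ (@gl_band K) (@gl_band_closed K).
HB.instance Definition _ (K : fieldType) := [SubChoice_isSubLmodule of gl K by <:].

Lemma glP (K : fieldType) (A B : gl K) : (forall u v, A u v = B u v) -> A = B.
Proof. by move=> AB; apply/val_inj/funext => u; apply/funext => v; apply: AB. Qed.

Lemma glDE (K : fieldType) (A B : gl K) u v : (A + B) u v = A u v + B u v.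
Proof. by []. Qed.
Lemma glZE (K : fieldType) c (A : gl K) u v : (c *: A) u v = c * A u v.
Proof. by []. Qed.

Fact gl_mul_subproof (K : fieldType) (A B : gl K) :
  (fun u v => \sum_(w \in [set: int]) A u w * B w v) \in @gl_band K.
Proof.
have [N AN] := gl_bound A; have [M BM] := gl_bound B.
apply/asboolP; exists (N + M)%N => u v uvNM; apply: fsbig1 => w _.
have [uwN|uwN] := ltnP N `|u - w|%N; first by rewrite AN// mul0r.
by rewrite BM ?mulr0//; lia.
Qed.
Definition gl_mul (K : fieldType) (A B : gl K) : gl K := MkGl (gl_mul_subproof A B).

Fact gl_one_subproof (K : fieldType) :
  (fun u v : int => (u == v)%:R) \in @gl_band K.
Proof. by apply/asboolP; exists 0%N => u v uv; rewrite (_ : u == v = false)//; lia. Qed.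
Definition gl_one (K : fieldType) : gl K := MkGl (gl_one_subproof K).

Section GlRing.
Variable K : fieldType.
Implicit Types A B C : gl K.

Lemma gl_mulE A B N u v : (forall w : int, (N < `|w|)%N -> A u w = 0) ->
  gl_mul A B u v = \sum_(w <- zball N) A u w * B w v.
Proof. by move=> AN; apply: fsumZ => w wN; rewrite AN// mul0r. Qed.

Lemma gl_rowP A u : exists N : nat, forall w : int, (N < `|w|)%N -> A u w = 0.
Proof.
by have [N AN] := gl_bound A; exists (N + `|u|)%N => w wN; apply: AN; lia.
Qed.

Fact gl_mulDl : left_distributive (@gl_mul K) +%R.
Proof.
move=> A B C; apply: glP => u v.
have [N AN] := gl_rowP A u; have [M BM] := gl_rowP B u.
have AX w : (maxn N M < `|w|)%N -> A u w = 0 by move=> wX; apply: AN; lia.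
have BX w : (maxn N M < `|w|)%N -> B u w = 0 by move=> wX; apply: BM; lia.
have ABX w : (maxn N M < `|w|)%N -> (A + B) u w = 0.
  by move=> wX; rewrite glDE AX// BX// addr0.
rewrite glDE (gl_mulE _ _ AX) (gl_mulE _ _ BX) (gl_mulE _ _ ABX) -big_split.
by apply: eq_bigr => w _; rewrite /= -mulrDl.
Qed.

Fact gl_mulDr : right_distributive (@gl_mul K) +%R.
Proof.
move=> A B C; apply: glP => u v; have [N AN] := gl_rowP A u.
rewrite glDE !(gl_mulE _ _ AN) -big_split.
by apply: eq_bigr => w _; rewrite /= -mulrDr.
Qed.

Fact gl_mul1 : left_id (gl_one K) (@gl_mul K).
Proof.
move=> A; apply: glP => u v; rewrite /= (fsumZ1 (k0 := u)) => [|w wu].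
  by rewrite eqxx mul1r.
by rewrite eq_sym (negPf wu) mul0r.
Qed.

Fact gl_mulr1 : right_id (gl_one K) (@gl_mul K).
Proof.
move=> A; apply: glP => u v; rewrite /= (fsumZ1 (k0 := v)) => [|w /negPf wv].
  by rewrite eqxx mulr1.
by rewrite wv mulr0.
Qed.

Fact gl_mulA : associative (@gl_mul K).
Proof.
move=> A B C; apply: glP => u v.
have [N AN] := gl_bound A; have [M BM] := gl_bound B.
have AX w : (N + M + `|u| < `|w|)%N -> A u w = 0 by move=> wX; apply: AN; lia.
have ABX w : (N + M + `|u| < `|w|)%N -> gl_mul A B u w = 0.
  move=> wX; rewrite (gl_mulE _ _ AX); apply: big1 => z _.
  have [uz|uz] := ltnP N `|u - z|%N; first by rewrite AN// mul0r.
  by rewrite BM ?mulr0//; lia.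
rewrite (gl_mulE _ _ AX) (gl_mulE _ _ ABX).
under [RHS]eq_bigr => w _ do rewrite (gl_mulE _ _ AX) mulr_suml.
rewrite exchange_big; apply: eq_bigr => z _ /=.
have [uz|uz] := ltnP N `|u - z|%N.
  by rewrite AN// mul0r big1// => w _; rewrite !mul0r.
rewrite (fsumZ (N := (N + M + `|u|)%N)) => [|w wX]; last by rewrite BM ?mul0r//; lia.
by rewrite mulr_sumr; apply: eq_bigr => w _; rewrite mulrA.
Qed.

Fact gl_one_neq0 : gl_one K != 0.
Proof.
apply/eqP => /(congr1 (fun A : gl K => A 0 0)) /= /eqP.
by rewrite oner_eq0.
Qed.
End GlRing.

HB.instance Definition _ (K : fieldType) := GRing.Zmodule_isNzRing.Build (gl K)
  (@gl_mulA K) (@gl_mul1 K) (@gl_mulr1 K) (@gl_mulDl K) (@gl_mulDr K) (@gl_one_neq0 K).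

Fact gl_scalerAl (K : fieldType) (c : K) (A B : gl K) : c *: (A * B) = c *: A * B.
Proof.
apply: glP => u v; have [N AN] := gl_rowP A u.
have cAN w : (N < `|w|)%N -> (c *: A) u w = 0 by move=> wN; rewrite glZE AN// mulr0.
rewrite glZE (gl_mulE _ _ AN) (gl_mulE _ _ cAN) mulr_sumr.
by apply: eq_bigr => w _; rewrite glZE mulrA.
Qed.
HB.instance Definition _ (K : fieldType) :=
  GRing.Lmodule_isLalgebra.Build K (gl K) (@gl_scalerAl K).

Fact gl_scalerAr (K : fieldType) (c : K) (A B : gl K) : c *: (A * B) = A * (c *: B).
Proof.
apply: glP => u v; have [N AN] := gl_rowP A u.
rewrite glZE !(gl_mulE _ _ AN) mulr_sumr.
by apply: eq_bigr => w _; rewrite glZE mulrCA.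
Qed.
HB.instance Definition _ (K : fieldType) :=
  GRing.Lalgebra_isAlgebra.Build K (gl K) (@gl_scalerAr K).

(* Supercommutator of an associative superalgebra A, part e being the         *)
(* projection of A onto its component of parity e.                            *)
Definition scomm (A : pzRingType) (part : bool -> A -> A) (x y : A) : A :=
  \sum_(d : bool) \sum_(e : bool)
    (part d x * part e y - (-1) ^+ (d && e) * (part e y * part d x)).

(* L (+) K c with c central, for a bracket br and a cocycle psi on L; c is    *)
(* even. K^o is K as a module over itself.                                    *)
Definition ext (K : fieldType) (L : lmodType K) : lmodType K := (L * K^o)%type.
Definition ext_part (K : fieldType) (L : lmodType K) (part : bool -> L -> L)
  (e : bool) (x : ext L) : ext L := (part e x.1, if e then 0 else x.2).
Definition ext_br (K : fieldType) (L : lmodType K) (br : L -> L -> L)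
  (psi : L -> L -> K) (x y : ext L) : ext L := (br x.1 y.1, psi x.1 y.1).
Definition ext_in (K : fieldType) (L : lmodType K) (x : L) : ext L := (x, 0).
Definition ext_c (K : fieldType) (L : lmodType K) : ext L := (0, 1).

(* Homomorphisms of Lie superalgebras: even linear maps compatible with the   *)
(* brackets.                                                                  *)
Definition lie_superhom (K : fieldType) (L L' : lmodType K)
    (part : bool -> L -> L) (br : L -> L -> L)
    (part' : bool -> L' -> L') (br' : L' -> L' -> L') (f : L -> L') : Prop :=
  [/\ linear f,
      forall (e : bool) (x : L), part e x = x -> part' e (f x) = f x
    & forall x y : L, f (br x y) = br' (f x) (f y)].

(* M_0, M_1 are even and M_+, M_- are odd. *)
Definition mparity (a : mindex) : bool := a.1 (+) a.2.

Definition coef_part (K : fieldType) (e : bool) (F : mindex -> {poly K}) :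
    mindex -> {poly K} := fun a => if mparity a == e then F a else 0.

Fact SD_part_subproof (K : fieldType) (e : bool) (x : SD K) :
  (fun k => coef_part e (x k)) \in @SD_support K.
Proof.
have [N xN] := SD_bound x; apply/asboolP; exists N => k kN; apply/funext => a.
by rewrite /coef_part xN// if_same.
Qed.
Definition SD_part (K : fieldType) (e : bool) (x : SD K) : SD K :=
  MkSD (SD_part_subproof e x).

(* Psi(t^r F(D), t^(-r) G(D)) for r >= 0; the summation variable is j = - i. *)
Definition Psi_nat (K : fieldType) (r : nat) (F G : mindex -> {poly K}) : K :=
  \sum_(1 <= i < r.+1)
    let j : K := - i%:R in
    (F M0).[j] * (G M0).[j + r%:R] + (F Mp).[j] * (G Mm).[j + r%:R]
  - (F Mm).[j] * (G Mp).[j + r%:R] - (F M1).[j] * (G M1).[j + r%:R].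

(* For r < 0, Psi(x, y) = - (-1)^(|x||y|) Psi(y, x) on parity components. *)
Definition Psi_int (K : fieldType) (r : int) (F G : mindex -> {poly K}) : K :=
  match r with
  | Posz n => Psi_nat n F G
  | Negz n => - \sum_(d : bool) \sum_(e : bool)
                  (-1) ^+ (d && e) * Psi_nat n.+1 (coef_part e G) (coef_part d F)
  end.

Definition Psi (K : fieldType) (x y : SD K) : K :=
  \sum_(r \in [set: int]) Psi_int r (x r) (y (- r)).

Definition SDhat (K : fieldType) : lmodType K := ext (SD K).
Definition SDhat_part (K : fieldType) : bool -> SDhat K -> SDhat K :=
  ext_part (@SD_part K).
Definition SDhat_br (K : fieldType) : SDhat K -> SDhat K -> SDhat K :=
  ext_br (scomm (@SD_part K)) (@Psi K).

(* Twice the weight of M_a: wt(theta) = 1/2, wt(d/dtheta) = - 1/2. *)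
Definition wt2 (a : mindex) : int := (a.1 : nat)%:Z - (a.2 : nat)%:Z.

(* The component of degree d/2 of the principal gradation. *)
Definition SDhat_deg (K : fieldType) (d : int) (x : SDhat K) : Prop :=
  (forall (k : int) (a : mindex), x.1 k a != 0 -> 2 * k + wt2 a = d) /\
  (x.2 != 0 -> d = 0).

(* E_ij is even iff i - j is an integer, i.e. iff u - v is even.              *)
Fact gl_part_subproof (K : fieldType) (e : bool) (A : gl K) :
  (fun u v => if odd `|u - v|%N == e then A u v else 0) \in @gl_band K.
Proof.
have [N AN] := gl_bound A; apply/asboolP; exists N => u v uvN.
by rewrite AN// if_same.
Qed.
Definition gl_part (K : fieldType) (e : bool) (A : gl K) : gl K :=
  MkGl (gl_part_subproof e A).

Fact gl_J_subproof (K : fieldType) :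
  (fun u v : int => ((u == v) && (u <= 0))%:R) \in @gl_band K.
Proof. by apply/asboolP; exists 0%N => u v uv; rewrite (_ : u == v = false)//; lia. Qed.
Definition gl_J (K : fieldType) : gl K := MkGl (gl_J_subproof K).

(* The supertrace; only meaningful when finitely many diagonal entries are    *)
(* nonzero, which holds for [J, A] B.                                         *)
Definition Str (K : fieldType) (A : gl K) : K :=
  \sum_(u \in [set: int]) (-1) ^ u * A u u.

Definition alpha (K : fieldType) (A B : gl K) : K :=
  Str (scomm (@gl_part K) (gl_J K) A * B).

Definition glhat (K : fieldType) : lmodType K := ext (gl K).
Definition glhat_part (K : fieldType) : bool -> glhat K -> glhat K :=
  ext_part (@gl_part K).
Definition glhat_br (K : fieldType) : glhat K -> glhat K -> glhat K :=
  ext_br (scomm (@gl_part K)) (@alpha K).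

(* The entry of E_ij M_a at (u/2, v/2), for i, j in Z. *)
Definition EM (K : fieldType) (i j : int) (a : mindex) (u v : int) : K :=
  let E p q := ((u == p) && (v == q))%:R in
  match a with
  | (false, false) => E (2 * i) (2 * j)
  | (true, true) => E (2 * i - 1) (2 * j - 1)
  | (false, true) => E (2 * i) (2 * j - 1)
  | (true, false) => E (2 * i - 1) (2 * j)
  end.

Fact phi_subproof (K : fieldType) (s : K) (x : SD K) :
  (fun u v => \sum_(k \in [set: int]) \sum_(a : mindex) \sum_(j \in [set: int])
     (x k a).[- j%:~R + s] * EM K (j - k) j a u v) \in @gl_band K.
Proof.
have [N xN] := SD_bound x; apply/asboolP; exists N.*2.+1 => u v uvN.
apply: fsbig1 => k _; apply: big1 => a _; apply: fsbig1 => j _.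
have [kN|kN] := ltnP N `|k|%N; first by rewrite xN// horner0 mul0r.
rewrite (_ : EM K (j - k) j a u v = 0) ?mulr0// /EM.
by case: a => -[] [] /=; case: eqP => //= up; case: eqP => //= vq; lia.
Qed.
(* phi_s(t^k f(D) M_a) = sum_j f(- j + s) E_(j-k,j) M_a, extended linearly *)
Definition phi (K : fieldType) (s : K) (x : SD K) : gl K := MkGl (phi_subproof s x).

(* Formal power series in x, as sequences of coefficients. *)
Definition fps_mul (K : fieldType) (p q : nat -> K) : nat -> K :=
  fun n => \sum_(i < n.+1) p i * q (n - i)%N.
(* e^(c x) - 1 *)
Definition fps_expm1 (K : fieldType) (c : K) : nat -> K :=
  fun n => c ^+ n / (n`!)%:R - (n == 0)%:R.
(* e^(x D) y, with coefficients in SD *)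
Definition fps_expD (K : fieldType) (y : SD K) : nat -> SD K :=
  fun n => (n`!%:R)^-1 *: (SD_D K ^+ n * y).

(* q is the power series (e^(s x) - 1) / (e^x - 1). *)
Definition phihat_spec (K : fieldType) (s : K) (f : SDhat K -> glhat K) : Prop :=
  [/\ linear f,
      forall (d : int) (x : SDhat K), d != 0 -> SDhat_deg d x -> f x = ext_in (phi s x.1),
      exists q : nat -> K,
        [/\ fps_mul q (fps_expm1 1) = fps_expm1 s,
            forall n, let y := fps_expD (SD_dtheta K * SD_theta K) n in
              f (ext_in y) = ext_in (phi s y) - q n *: ext_c (gl K)
          & forall n, let y := fps_expD (SD_theta K * SD_dtheta K) n in
              f (ext_in y) = ext_in (phi s y) + q n *: ext_c (gl K)]
    & f (ext_c (SD K)) = ext_c (gl K)].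

(* Main.v *)
From HB Require Import structures.
Require Import Defs.
From mathcomp Require Import all_boot all_order all_algebra zify ring.
From mathcomp Require Import boolp classical_sets fsbigop.
From mathcomp Require Import reals complex.

Set Implicit Arguments.
Unset Strict Implicit.
Unset Printing Implicit Defensive.

Import Order.TTheory GRing.Theory Num.Theory.
Local Open Scope ring_scope.

(** The map [phihat] adds to [phi s] a central term, a linear functional
    [correction] of the even diagonal part of degree zero.  As [phi s] is a
    homomorphism of associative superalgebras, [phihat] respects the brackets
    exactly when [correction] of a supercommutator is the difference of
    [alpha (phi s x) (phi s y)] and [Psi x y].

    Both cocycles are instances of one expression.  Write u = 2i - p for a doubled
    half-integer, with i an integer and p in {0, 1}; then u <= 0 iff i <= 0, so
    [J, A] only sees the integer parts of the indices, and
    [alpha (phi s x) (phi s y)] is the sum over k, p, b, with sign (-1)^p, of the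
    values h(s + m) at the integers m with -k <= m < 0, where h(D) is the product
    x_k(D)_pb y_(-k)(D + k)_bp ([alpha_phi]).  For k < 0 the values with
    0 <= m < -k are counted with a minus sign; [stair] is this sum over m.  Super
    skew-symmetry prescribes the same rule for [Psi], which is therefore the same
    expression at s = 0 ([Psi_cocycle]).

    On the other side, the supertrace of the degree-zero diagonal of a
    supercommutator is the sum, with the same signs, of the differences
    h(D - k) - h(D) ([scomm_diag]).  The functional L on polynomials with
    L(e^(xD)) = q(x) = (e^(sx) - 1) / (e^x - 1) satisfies
    L(e^(x(D+1)) - e^(xD)) = e^(sx) - 1, that is
    L(f(D + 1) - f(D)) = f(s) - f(0) ([egf_eval_diff]).  Telescoping gives
    L(h(D) - h(D - k)) = [stair] of h(s + m) minus [stair] of h(m)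
    ([egf_eval_stair]), which is the required difference of cocycles
    ([correction_scomm]).

    Uniqueness holds because e^x - 1 has order one, so that q is determined, and
    because the elements t^k D^n M_a and C span the algebra; those of them of
    degree zero are C, D^n M_0 and D^n M_1, where the map is prescribed. *)

(** * Sums over integers and half-integers *)

(** A doubled half-integer u is written 2 i - p, where p tells the integers from
    the proper half-integers: this is how M_0, M_1, M_+, M_- number the rows and
    columns of the 2 x 2 block of E_ij. *)
Lemma half_coord (u : int) : exists (i : int) (p : bool), u = 2 * i - p%:Z.
Proof.
case: u => n.
  exists (uphalf n)%:Z, (odd n); have := odd_double_half n; rewrite uphalf_half; lia.
exists (- n.+1./2%:Z), (odd n.+1); have := odd_double_half n.+1; lia.
Qed.

Lemma half_coord_inj (i j : int) (p q : bool) :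
  (2 * i - p%:Z == 2 * j - q%:Z) = (i == j) && (p == q).
Proof. by case: p q => -[]; lia. Qed.

Lemma half_coord_le0 (i : int) (p : bool) : (2 * i - p%:Z <= 0) = (i <= 0).
Proof. by case: p; lia. Qed.

Lemma fsum_half_coord (V : nmodType) (F : int -> V) N :
  (forall u, (N < `|u|)%N -> F u = 0) ->
  \sum_(u \in [set: int]) F u = \sum_(i \in [set: int]) \sum_(p : bool) F (2 * i - p%:Z).
Proof.
move=> F0.
have F0' i : (N < `|i|)%N -> \sum_(p : bool) F (2 * i - p%:Z) = 0.
  by move=> iN; rewrite big1// => p _; apply: F0; case: p; lia.
rewrite (fsumZ F0) (fsumZ F0').
transitivity (\sum_(u <- zball N) \sum_(i <- zball N) \sum_(p : bool)
    if u == 2 * i - p%:Z then F u else 0).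
  rewrite big_seq [RHS]big_seq; apply: eq_bigr => u; rewrite mem_zball => uN.
  (* Exactly one pair (i, p) satisfies u = 2 i - p. *)
  have [i [p uE]] := half_coord u; rewrite -(@fsumZ V (fun i => \sum_(p : bool) _)); last first.
    by move=> j jN; rewrite big1// => q _; case: eqP => //; case: (q); lia.
  rewrite (fsumZ1 (k0 := i)) => [|j ji].
    rewrite (bigD1 p)//= uE eqxx big1 ?addr0// => q qp.
    by rewrite half_coord_inj eqxx eq_sym (negPf qp).
  by rewrite big1// => q _; rewrite uE half_coord_inj eq_sym (negPf ji).
rewrite exchange_big; apply: eq_bigr => i _; rewrite exchange_big; apply: eq_bigr => p _ /=.
rewrite -(@fsumZ V (fun u => if _ then _ else _)) => [|u uN]; last by rewrite F0// if_same.
by rewrite (fsumZ1 (k0 := 2 * i - p%:Z)) ?eqxx// => u /negPf->.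
Qed.

Lemma fsum_shift (V : nmodType) (F : int -> V) (a : int) :
  \sum_(k \in [set: int]) F k = \sum_(k \in [set: int]) F (a + k).
Proof.
apply: (reindex_fsbigT (fun k => a + k)) => /=.
by exists (fun m => m - a) => m; lia.
Qed.

Lemma fsum_opp (V : nmodType) (F : int -> V) :
  \sum_(k \in [set: int]) F k = \sum_(k \in [set: int]) F (- k).
Proof.
apply: (reindex_fsbigT (fun k => - k)) => /=.
by exists (fun m => - m) => m; lia.
Qed.

Lemma fsumZ_add (V : nmodType) (F G : int -> V) N :
  (forall k, (N < `|k|)%N -> F k = 0) -> (forall k, (N < `|k|)%N -> G k = 0) ->
  \sum_(k \in [set: int]) (F k + G k) =
  \sum_(k \in [set: int]) F k + \sum_(k \in [set: int]) G k.
Proof.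
move=> F0 G0; rewrite (fsumZ F0) (fsumZ G0) (fsumZ (N := N)) ?big_split// => k kN.
by rewrite F0// G0// addr0.
Qed.

Lemma fsum_exchange (V : nmodType) (F : int -> int -> V) N :
  (forall i k, (N < `|i|)%N -> F i k = 0) -> (forall i k, (N < `|k|)%N -> F i k = 0) ->
  \sum_(i \in [set: int]) \sum_(k \in [set: int]) F i k =
  \sum_(k \in [set: int]) \sum_(i \in [set: int]) F i k.
Proof.
move=> F0 F1.
rewrite (fsumZ (N := N)) => [|i iN]; last by apply: fsbig1 => k _; apply: F0.
rewrite [RHS](fsumZ (N := N)) => [|k kN]; last by apply: fsbig1 => i _; apply: F1.
under eq_bigr => i _ do rewrite (fsumZ (F1 i)).
by rewrite exchange_big; apply: eq_bigr => k _; rewrite (fsumZ (F0^~ k)).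
Qed.

(** * Signed sums between two integers *)

Section Stair.
Variable K : fieldType.

(** The sum of h over [-k, 0) for k >= 0, and minus the sum of h over [0, -k) for
    k <= 0.  Writing it with indicators treats both signs of k at once, and is the
    form in which the commutator with [gl_J] produces it. *)
Definition stair (k : int) (h : K -> K) : K :=
  \sum_(m \in [set: int]) ((- k <= m)%R%:R - (0 <= m)%R%:R) * h m%:~R.

Lemma stair_supp (h : K -> K) (k m : int) : (`|k| < `|m|)%N ->
  ((- k <= m)%R%:R - (0 <= m)%R%:R) * h m%:~R = 0.
Proof.
move=> km; rewrite (_ : (- k <= m) = (0 <= m)) ?subrr ?mul0r//.
by apply/idP/idP; lia.
Qed.

Lemma stair0 h : stair 0 h = 0.
Proof. by apply: fsbig1 => m _; rewrite oppr0 subrr mul0r. Qed.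

Lemma stairS k h : stair (k + 1) h = stair k h + h (- (k + 1)%:~R).
Proof.
pose d m : K := if m == - (k + 1) then h m%:~R else 0.
have dE : h (- (k + 1)%:~R) = \sum_(m \in [set: int]) d m.
  rewrite (fsumZ1 (k0 := - (k + 1))) /d ?eqxx ?mulrNz// => m /negPf->//.
rewrite dE -(@fsumZ_add _ _ _ (`|k| + 1)%N) => [|m km|m km]; last first.
- by rewrite /d ifF//; lia.
- by rewrite stair_supp//; lia.
apply: eq_fsbigr => m _; rewrite /d; case: eqP => [->|mk].
  rewrite lexx (_ : (- k <= - (k + 1)) = false); last by lia.
  by rewrite /=; ring.
rewrite addr0 (_ : (- (k + 1) <= m) = (- k <= m))//; lia.
Qed.

(** Telescoping: to identify a function of an integer with [stair] it suffices to
    compare increments, with no separate treatment of negative integers. *)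
Lemma stair_uniq (F : int -> K) h :
  F 0 = 0 -> (forall k, F (k + 1) = F k + h (- (k + 1)%:~R)) -> forall k, F k = stair k h.
Proof.
move=> F0 FS; elim/int_rect => [|n IH|n IH]; first by rewrite stair0.
  by rewrite -[n.+1]addn1 PoszD FS IH stairS.
apply: (@addIr _ (h (- (- n.+1%:Z + 1)%:~R))); rewrite -FS -stairS.
by rewrite (_ : - n.+1%:Z + 1 = - n%:Z) ?IH//; lia.
Qed.

Lemma stair_pos (n : nat) h : stair n h = \sum_(1 <= i < n.+1) h (- i%:R).
Proof.
elim: n => [|n IH]; first by rewrite stair0 big_nil.
by rewrite big_nat_recr//= -IH -[in LHS]addn1 PoszD stairS -PoszD addn1.
Qed.

Lemma stair_neg (n : nat) h : stair (- n%:Z) h = - \sum_(1 <= i < n.+1) h (- i%:R + n%:R).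
Proof.
suff -> : \sum_(1 <= i < n.+1) h (- i%:R + n%:R) = \sum_(i < n) h i%:R.
  elim: n => [|n IH]; first by rewrite stair0 big_ord0 oppr0.
  rewrite big_ord_recr /= opprD -IH; apply: (addIr (h n%:R)).
  rewrite subrK (_ : - n%:Z = - n.+1%:Z + 1); last by lia.
  rewrite stairS; congr (_ + h _).
  by rewrite -mulrNz (_ : - (- n.+1%:Z + 1) = n%:Z)//; lia.
(* The summation variable is reversed, i = n - j with 0 <= j < n. *)
rewrite big_add1 /= big_nat_rev big_mkord; apply: eq_bigr => -[i ni] _ /=.
congr h; rewrite (_ : (0 + n - i.+1).+1 = (n - i)%N); last by lia.
by rewrite natrB ?(ltnW ni)//; ring.
Qed.
End Stair.

(** * The functional with exponential generating function q *)

Lemma poly_linear_ind (K : fieldType) (P : {poly K} -> Prop) :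
  P 0 -> (forall c f g, P f -> P g -> P (c *: f + g)) -> (forall n, P 'X^n) ->
  forall f, P f.
Proof.
move=> P0 PD PX f; rewrite -[f]coefK poly_def.
by elim/big_rec: _ => // i g _; apply: PD.
Qed.

Lemma horner_shiftp (K : fieldType) l (f : {poly K}) z :
  (shiftp l f).[z] = f.[z + l%:~R].
Proof. by rewrite /shiftp horner_comp !hornerE. Qed.

Section PowerSeries.
Variable K : fieldType.
Implicit Types b d q : nat -> K.

(** As b has no constant term, the coefficient of degree n + 1 of q b involves
    q_0, ..., q_n only, and q_n through the factor b_1: this triangular shape makes
    division by b possible and unique. *)
Lemma fps_mulS q b n : b 0%N = 0 ->
  fps_mul q b n.+1 = \sum_(i < n) q i * b (n.+1 - i)%N + q n * b 1%N.
Proof.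
move=> b0; rewrite /fps_mul !big_ord_recr /= subnn b0 mulr0 addr0.
by rewrite subSn// subnn.
Qed.

(** The coefficients of d / b are built as a list because each of them depends on
    all the previous ones. *)
Fixpoint fps_div_seq d b (n : nat) : seq K :=
  if n is m.+1 then
    let s := fps_div_seq d b m in
    rcons s ((d n - \sum_(i < m) s`_i * b (n - i)%N) / b 1%N)
  else [::].

Definition fps_div d b (n : nat) : K := (fps_div_seq d b n.+1)`_n.

Lemma size_fps_div_seq d b n : size (fps_div_seq d b n) = n.
Proof. by elim: n => //= n IH; rewrite size_rcons IH. Qed.

Lemma nth_fps_div_seq d b n i : (i < n)%N -> (fps_div_seq d b n)`_i = fps_div d b i.
Proof.
elim: n => // n IH; rewrite ltnS leq_eqVlt => /predU1P[->//|i_n].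
by rewrite /= nth_rcons size_fps_div_seq i_n IH.
Qed.

Lemma fps_divK d b : d 0%N = 0 -> b 0%N = 0 -> b 1%N != 0 ->
  fps_mul (fps_div d b) b = d.
Proof.
move=> d0 b0 b1; apply/funext => -[|n].
  by rewrite /fps_mul big_ord_recl big_ord0 /= subnn b0 d0 mulr0 addr0.
rewrite fps_mulS// {2}/fps_div /= nth_rcons size_fps_div_seq ltnn eqxx divfK//.
by under [X in _ - X]eq_bigr => i _ do rewrite nth_fps_div_seq//; rewrite addrC subrK.
Qed.

Lemma fps_mulI b q q' : b 0%N = 0 -> b 1%N != 0 ->
  fps_mul q b = fps_mul q' b -> q = q'.
Proof.
move=> b0 b1 E; apply/funext => n; elim/ltn_ind: n => n IH.
have := congr1 (@^~ n.+1) E; rewrite !fps_mulS//.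
under eq_bigr => i _ do rewrite IH//.
by move/addrI/(mulIf b1).
Qed.

Lemma fps_expm1_0 c : fps_expm1 c 0 = 0 :> K.
Proof. by rewrite /fps_expm1 expr0 divr1 subrr. Qed.

Lemma fps_expm1_1 c : fps_expm1 c 1 = c :> K.
Proof. by rewrite /fps_expm1 expr1 divr1 subr0. Qed.

(** The linear functional on polynomials in D that formally maps e^(xD) to the
    power series q(x), that is D^n to n! q_n. *)
Definition egf_eval q (f : {poly K}) : K^o := \sum_(n < size f) n`!%:R * q n * f`_n.

Lemma egf_evalE q (f : {poly K}) N : (size f <= N)%N ->
  egf_eval q f = \sum_(n < N) n`!%:R * q n * f`_n.
Proof.
move=> fN; rewrite -(subnK fN) addnC big_split_ord /= [X in _ = _ + X]big1 ?addr0// => i _.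
by rewrite nth_default ?mulr0// leq_addr.
Qed.

Fact egf_eval_linear q : linear (egf_eval q).
Proof.
move=> c f g; set N := maxn (size (c *: f + g)) (maxn (size f) (size g)).
rewrite (@egf_evalE _ f N) ?(@egf_evalE _ g N) ?(@egf_evalE _ (c *: f + g) N) ?/N; try lia.
rewrite scaler_sumr -big_split; apply: eq_bigr => i _ /=.
by rewrite coefD coefZ mulrDr /GRing.scale /= mulrCA.
Qed.
HB.instance Definition _ q :=
  GRing.isLinear.Build K {poly K} K^o _ (egf_eval q) (@egf_eval_linear q).

Lemma egf_evalXn q n : egf_eval q 'X^n = n`!%:R * q n.
Proof.
rewrite (@egf_evalE _ _ n.+1) ?size_polyXn// big_ord_recr /= coefXn eqxx mulr1.
by rewrite big1 ?add0r// => i _; rewrite coefXn ltn_eqF ?mulr0.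
Qed.

Hypothesis K0 : [pchar K] =i pred0.

Lemma fact_neq0 n : n`!%:R != 0 :> K.
Proof. by rewrite ((pcharf0P _).1 K0) -lt0n fact_gt0. Qed.

(** Coefficientwise this is the identity q(x) (e^x - 1) = e^(sx) - 1, because
    e^(x(D+1)) - e^(xD) = (e^x - 1) e^(xD). *)
Lemma egf_eval_diff q s (f : {poly K}) : fps_mul q (fps_expm1 1) = fps_expm1 s ->
  egf_eval q (shiftp 1 f - f) = f.[s] - f.[0].
Proof.
move=> qE; elim/poly_linear_ind: f => [|c f g IHf IHg|m].
- by rewrite shiftp0 !horner0 !subrr raddf0.
- rewrite shiftpD shiftpZ opprD addrACA -scalerBr linearP /= IHf IHg !hornerE /GRing.scale /=.
  by ring.
rewrite raddfB /= egf_evalXn /shiftp comp_Xn_poly mulr1z polyC1 ['X + _]addrC exprDn.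
rewrite raddf_sum /= !hornerXn.
have <- : m`!%:R * fps_expm1 s m = s ^+ m - 0 ^+ m.
  rewrite /fps_expm1 mulrBr mulrC divfK ?fact_neq0// expr0n; case: (m) => [|n].
    by rewrite mulr1.
  by rewrite mulr0.
rewrite -qE /fps_mul mulr_sumr.
rewrite [in RHS]big_ord_recr /= subnn fps_expm1_0 !mulr0 addr0 big_ord_recr /=.
rewrite subnn binn expr0 mulr1n mul1r egf_evalXn addrK; apply: eq_bigr => -[i im] _ /=.
rewrite expr1n mul1r raddfMn /= egf_evalXn /fps_expm1 expr1n.
rewrite (_ : (m - i == 0)%N = false) ?subr0 ?div1r; last by lia.
rewrite -(bin_fact (ltnW im)) !natrM -mulr_natl.
by have := fact_neq0 (m - i); move=> ?; field.
Qed.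

(** Both sides vanish at k = 0, and the increment in k of the left-hand side is
    given by [egf_eval_diff] applied to f(D - k - 1). *)
Lemma egf_eval_stair q s (f : {poly K}) k : fps_mul q (fps_expm1 1) = fps_expm1 s ->
  egf_eval q (f - shiftp (- k) f) = stair k (fun z => f.[s + z]) - stair k (horner f).
Proof.
move=> qE.
pose F k := egf_eval q (f - shiftp (- k) f) + stair k (horner f).
suff /(_ k) <- : forall k, F k = stair k (fun z => f.[s + z]) by rewrite /F addrK.
apply: stair_uniq => [|j]; first by rewrite /F oppr0 shiftp0z subrr raddf0 stair0 addr0.
have := @egf_eval_diff q s (shiftp (- (j + 1)) f) qE.
rewrite shiftp_shiftp (_ : 1 - (j + 1) = - j) ?raddfB; last by lia.
rewrite !horner_shiftp add0r mulrNz => E; rewrite /F !raddfB /= stairS.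
rewrite (_ : egf_eval q (shiftp (- (j + 1)) f) = egf_eval q (shiftp (- j) f) -
  (f.[s - (j + 1)%:~R] - f.[- (j + 1)%:~R])); last by rewrite -E subKr.
by ring.
Qed.
End PowerSeries.

(** * The embedding of SD into matrices *)

Section Phi.
Variable K : fieldType.
Implicit Types (x y : SD K) (A B : gl K).

Lemma EM_half_coord (i j i' j' : int) (p q : bool) (a : mindex) :
  Defs.EM K i' j' a (2 * i - p%:Z) (2 * j - q%:Z) =
  [&& i == i', p == a.1, j == j' & q == a.2]%:R.
Proof.
rewrite andbA /Defs.EM; case: a => -[] [] /=; congr (_ && _)%:R;
  by case: p q => -[]; apply/idP/idP; lia.
Qed.

(** In the coordinates 2 i - p, the matrix of t^k f(D) M_(p,q) has the single
    nonzero diagonal j - i = k.  All later computations read [phi] through this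
    formula. *)
Lemma phiE (s : K) x (i j : int) (p q : bool) :
  phi s x (2 * i - p%:Z) (2 * j - q%:Z) = (x (j - i) (p, q)).[s - j%:~R].
Proof.
rewrite /= (fsumZ1 (k0 := j - i)) => [|k kji].
  rewrite (bigD1 (p, q))// [X in X = _]addrC [X in (X + _ = _)%R]big1 => [|[p' q'] pq].
    rewrite (fsumZ1 (k0 := j)) => [|j' j'j]; rewrite EM_half_coord.
      by rewrite add0r subKr !eqxx mulr1 [_ + s]addrC.
    by rewrite [X in [&& _, _, X & _]]eq_sym (negPf j'j) !andbF mulr0.
  apply: fsbig1 => j' _; rewrite EM_half_coord.
  case: and4P => [[/eqP _ /eqP pp /eqP _ /eqP qq]|_]; last by rewrite mulr0.
  by move: pq; rewrite pp qq eqxx.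
apply: big1 => a _; apply: fsbig1 => j' _; rewrite EM_half_coord.
case: and4P => [[/eqP ij _ /eqP jj' _]|_]; last by rewrite mulr0.
by move/eqP: kji; lia.
Qed.

Lemma gl_half_coordP A B :
  (forall (i j : int) (p q : bool),
     A (2 * i - p%:Z) (2 * j - q%:Z) = B (2 * i - p%:Z) (2 * j - q%:Z)) ->
  A = B.
Proof.
move=> AB; apply: glP => u v.
by have [i [p ->]] := half_coord u; have [j [q ->]] := half_coord v.
Qed.

Lemma phi_linear (s : K) : linear (phi s).
Proof.
move=> c x y; apply: gl_half_coordP => i j p q.
by rewrite glDE glZE !phiE SDDE SDZE hornerD hornerZ.
Qed.
HB.instance Definition _ s :=
  GRing.isLinear.Build K (SD K) (gl K) _ (phi s) (@phi_linear s).

(** The entry at (i, j) of the product is a sum over the intermediate index i + k;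
    evaluating at s - (i + k) instead of s - j is the shift f(D) t^l = t^l f(D + l). *)
Lemma phiM (s : K) x y : phi s (x * y) = phi s x * phi s y.
Proof.
apply: gl_half_coordP => i j p q; rewrite phiE.
have [N phiN] := gl_rowP (phi s x) (2 * i - p%:Z).
rewrite [RHS](@fsum_half_coord _ _ N) => [|w wN]; last by rewrite phiN// mul0r.
have [M xM] := SD_bound x.
rewrite -[(x * y) _ _]/(SD_mul x y (j - i) (p, q)) (SD_mulE _ _ _ xM) horner_sum.
rewrite -(@fsumZ _ (fun k => _.[_])) => [|k kM]; last first.
  by rewrite big1 ?horner0// => b _; rewrite xM// shiftp0 mul0r.
rewrite [RHS](fsum_shift _ i); apply: eq_fsbigr => k _.
rewrite horner_sum; apply: eq_bigr => b _.
rewrite !phiE hornerM horner_shiftp [i + k]addrC addrK.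
rewrite (_ : j - i - k = j - (k + i)); last by lia.
congr (_.[_] * _); rewrite rmorphB /=; ring.
Qed.

Lemma phi_part (s : K) e x : phi s (SD_part e x) = gl_part e (phi s x).
Proof.
apply: gl_half_coordP => i j p q; rewrite phiE.
rewrite -[gl_part _ _ _ _]/(if odd `|(2 * i - p%:Z - (2 * j - q%:Z))%R|%N == e
  then phi s x (2 * i - p%:Z) (2 * j - q%:Z) else 0) phiE.
rewrite -[SD_part _ _ _ _]/(if p (+) q == e then x (j - i) (p, q) else 0).
have -> : odd `|(2 * i - p%:Z - (2 * j - q%:Z))%R|%N = p (+) q by case: p q => -[]; lia.
by case: ifP => // _; rewrite horner0.
Qed.

Lemma phi_scomm (s : K) x y :
  phi s (scomm (@SD_part K) x y) = scomm (@gl_part K) (phi s x) (phi s y).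
Proof.
rewrite /scomm raddf_sum; apply: eq_bigr => d _; rewrite raddf_sum; apply: eq_bigr => e _.
rewrite raddfB /= -!phi_part -!phiM; congr (_ - _).
by case: (d && e); rewrite ?expr0 ?expr1 ?mul1r ?mulN1r ?raddfN.
Qed.

(** * The cocycles *)

Lemma gl_partD A : gl_part false A + gl_part true A = A.
Proof.
by apply: glP => u v; rewrite glDE /=; case: (odd _); rewrite /= ?add0r ?addr0.
Qed.

Lemma gl_part_J e : gl_part e (gl_J K) = if e then 0 else gl_J K.
Proof.
apply: glP => u v.
transitivity (if odd `|u - v|%N == e then ((u == v) && (u <= 0)%R)%:R else 0 : K) => //.
transitivity (if e then 0 else ((u == v) && (u <= 0)%R)%:R : K); last by case: e.
case: (eqVneq u v) => [->|uv]; first by rewrite subrr; case: e.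
by rewrite !if_same.
Qed.

Lemma scomm_J A : scomm (@gl_part K) (gl_J K) A = gl_J K * A - A * gl_J K.
Proof.
rewrite /scomm !big_bool !gl_part_J /= !mul0r !mulr0 !subr0 !add0r expr0 !mul1r.
by rewrite addrACA -opprD -mulrDr -mulrDl [gl_part true A + _]addrC gl_partD.
Qed.

Lemma commJE A u w :
  (gl_J K * A - A * gl_J K) u w = ((u <= 0)%R%:R - (w <= 0)%R%:R) * A u w.
Proof.
rewrite -[LHS]/((gl_J K * A) u w - (A * gl_J K) u w) mulrBl; congr (_ - _).
  rewrite /= (fsumZ1 (k0 := u)) ?eqxx// => v vu.
  by rewrite eq_sym (negPf vu) mul0r.
rewrite /= (fsumZ1 (k0 := w)) ?eqxx /= 1?mulrC// => v vu.
by rewrite (negPf vu) mulr0.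
Qed.

(** The polynomial h(D) = x_k(D)_(p,b) y_(-k)(D + k)_(b,p); summed over b, the
    shifts h(D - k) give the (p, p) entry of the product of t^k x_k(D) and
    t^(-k) y_(-k)(D). *)
Definition pairing x y (k : int) (p b : bool) : {poly K} :=
  x k (p, b) * shiftp k (y (- k) (b, p)).

(** The sum that is [alpha] pulled back along [phi s] and, for s = 0, is [Psi]. *)
Definition cocycle (s : K) x y : K :=
  \sum_(k \in [set: int]) \sum_(p : bool) \sum_(b : bool)
    (-1) ^+ p * stair k (fun z => (pairing x y k p b).[s + z]).

Lemma sign_half_coord (i : int) (p : bool) : (-1) ^ (2 * i - p%:Z) = (-1) ^+ p :> K.
Proof.
have N1 : -1 != 0 :> K by rewrite oppr_eq0 oner_eq0.
rewrite expfzDr// -exprz_exp -exprnP sqrrN expr1n exp1rz mul1r.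
by case: p => //; rewrite -exprnN expr1 invrN1.
Qed.

(** In the diagonal entry of [J, A] B at 2 i - p, the intermediate index
    2 (i + k) - b carries the factor [i <= 0] - [i + k <= 0].  Substituting i = - (k + m) turns it into the
    weight [-k <= m] - [0 <= m] of [stair]; it vanishes for all but finitely many i
    once k is bounded, which justifies the exchange of the sums over i and k. *)
Lemma alpha_phi (s : K) x y : alpha (phi s x) (phi s y) = cocycle s x y.
Proof.
have [N AN] := gl_bound (phi s x); have [M xM] := SD_bound x.
pose T (u w : int) : K := ((u <= 0)%R%:R - (w <= 0)%R%:R) * phi s x u w * phi s y w u.
have T0 u w : (N < `|u - w|)%N -> T u w = 0 by move=> uw; rewrite /T AN// mulr0 mul0r.
have T1 u w : (N < `|u|)%N -> T u w = 0.
  have [uw|uw uN] := ltnP N `|u - w|%N; first by rewrite T0.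
  by rewrite /T (_ : (u <= 0)%R = (w <= 0)%R) ?subrr ?mul0r//; apply/idP/idP; lia.
have -> : alpha (phi s x) (phi s y) =
    \sum_(u \in [set: int]) (-1) ^ u * \sum_(w \in [set: int]) T u w.
  rewrite /alpha /Str scomm_J; apply: eq_fsbigr => u _; congr (_ * _).
  by apply: eq_fsbigr => w _; rewrite commJE.
rewrite (@fsum_half_coord _ _ N) => [|u uN]; last first.
  by rewrite fsbig1 ?mulr0// => w _; rewrite T1.
pose S (i k : int) (p b : bool) : K :=
  (-1) ^+ p * (((i <= 0)%R%:R - (i + k <= 0)%R%:R) * (pairing x y k p b).[s - (i + k)%:~R]).
have S1 i k p b : (M < `|k|)%N -> S i k p b = 0.
  by move=> kM; rewrite /S /pairing xM// mul0r horner0 !mulr0.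
have S0 i k p b : (M < `|i|)%N -> S i k p b = 0.
  have [kM|kM iM] := ltnP M `|k|%N; first by rewrite S1.
  rewrite /S (_ : (i <= 0)%R = (i + k <= 0)%R) ?subrr ?mul0r ?mulr0//.
  by apply/idP/idP; lia.
transitivity (\sum_(i \in [set: int]) \sum_(k \in [set: int])
    \sum_(p : bool) \sum_(b : bool) S i k p b).
  apply: eq_fsbigr => i _; rewrite (fsumZ (N := M)) => [|k kM]; last first.
    by rewrite big1// => p _; rewrite big1// => b _; rewrite S1.
  rewrite exchange_big; apply: eq_bigr => p _ /=; rewrite sign_half_coord.
  rewrite (@fsum_half_coord _ _ (N + `|(2 * i - p%:Z)%R|)%N) => [|w wN]; last by rewrite T0//; lia.
  rewrite (fsum_shift _ i) -(@fsumZ _ (fun k => \sum_(b : bool) S i k p b)) => [|k kM].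
    rewrite mulr_fsumr; apply: eq_fsbigr => k _; rewrite mulr_sumr; apply: eq_bigr => b _.
    rewrite /T /S !half_coord_le0 !phiE /pairing hornerM horner_shiftp !mulrA.
    have -> : i + k - i = k by lia.
    have -> : i - (i + k) = - k by lia.
    rewrite -!mulrA; congr (_ * (_ * (_ * _.[_]))).
    by rewrite rmorphD opprD addrA subrK.
  by rewrite big1// => b _; rewrite S1.
rewrite (@fsum_exchange _ _ M); last 2 first.
- by move=> i k kM; rewrite big1// => p _; rewrite big1// => b _; rewrite S0.
- by move=> i k kM; rewrite big1// => p _; rewrite big1// => b _; rewrite S1.
apply: eq_fsbigr => k _; rewrite (fsumZ (N := M)) => [|i iM]; last first.
  by rewrite big1// => p _; rewrite big1// => b _; rewrite S0.
rewrite exchange_big; apply: eq_bigr => p _; rewrite exchange_big; apply: eq_bigr => b _ /=.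
rewrite -(@fsumZ _ (fun i => S i k p b)) => [|i iM]; last by rewrite S0.
rewrite fsum_opp (fsum_shift _ k) /stair mulr_fsumr; apply: eq_fsbigr => m _; rewrite /S.
rewrite (_ : (- (k + m) <= 0) = (- k <= m)); last by apply/idP/idP; lia.
have -> : - (k + m) + k = - m by lia.
by rewrite oppr_le0 mulrNz opprK.
Qed.

Lemma Psi_natE (n : nat) (F G : mindex -> {poly K}) :
  Psi_nat n F G = \sum_(p : bool) \sum_(b : bool)
    (-1) ^+ p * stair n (horner (F (p, b) * shiftp n (G (b, p)))).
Proof.
rewrite /Psi_nat !big_bool /= expr0 expr1 !mul1r !mulN1r !stair_pos.
rewrite -!sumrN -!big_split; apply: eq_bigr => i _ /=.
by rewrite !hornerM !horner_shiftp /M0 /M1 /Mp /Mm; ring.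
Qed.

(** The super skew-symmetry that defines [Psi] in negative degrees: exchanging the
    two arguments translates the summation interval from [-n, 0) to [0, n). *)
Lemma stair_shift (n : nat) (f g : {poly K}) :
  - stair n (horner (f * shiftp n g)) = stair (- n%:Z) (horner (g * shiftp (- n%:Z) f)).
Proof.
rewrite stair_pos stair_neg; congr (- _); apply: eq_bigr => i _.
by rewrite !hornerM !horner_shiftp mulrNz addrK mulrC.
Qed.

Lemma Psi_intE (k : int) (F G : mindex -> {poly K}) :
  Psi_int k F G = \sum_(p : bool) \sum_(b : bool)
    (-1) ^+ p * stair k (horner (F (p, b) * shiftp k (G (b, p)))).
Proof.
case: k => n; first exact: Psi_natE.
have stair_0 : stair n.+1 (horner (0 : {poly K})) = 0.
  by apply: fsbig1 => m _; rewrite horner0 mulr0.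
rewrite /= !big_bool /= !Psi_natE !big_bool /= /coef_part /mparity /=.
by rewrite !NegzE -!stair_shift !(shiftp0, mulr0, mul0r) !stair_0; ring.
Qed.

Lemma Psi_cocycle x y : Psi x y = cocycle 0 x y.
Proof.
apply: eq_fsbigr => k _; rewrite Psi_intE.
apply: eq_bigr => p _; apply: eq_bigr => b _; congr (_ * stair _ _).
by apply/funext => z; rewrite add0r.
Qed.

(** * The degree-zero diagonal of a supercommutator *)

Lemma SD_part_mul0 d e x y (p : bool) :
  (SD_part d x * SD_part e y) 0 (p, p) =
  \sum_(k \in [set: int]) \sum_(b : bool)
    if (d == p (+) b) && (e == p (+) b)
    then shiftp (- k) (x k (p, b)) * y (- k) (b, p) else 0.
Proof.
apply: eq_fsbigr => k _; apply: eq_bigr => b _; rewrite sub0r /= /coef_part /mparity /=.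
rewrite addbC [b (+) p]addbC ![_ == d]eq_sym ![_ == e]eq_sym.
by do 2![case: eqP => _]; rewrite /= ?shiftp0 ?mul0r ?mulr0.
Qed.

(** Only the parity p + b of both factors contributes at (p, p) with intermediate
    index b, so the sign (-1)^(|x||y|) becomes (-1)^(p + b).  After k is replaced by
    -k in the second product, both products involve the same [pairing], shifted and
    unshifted: in the supertrace over p they combine into h(D - k) - h(D). *)
Lemma scomm_diag x y (p : bool) :
  scomm (@SD_part K) x y 0 (p, p) =
  \sum_(k \in [set: int]) \sum_(b : bool)
    (shiftp (- k) (pairing x y k p b) - (-1) ^+ (p (+) b) *: pairing x y k b p).
Proof.
have [M xM] := SD_bound x.
have evD (F : bool -> SD K) : (\sum_d F d) 0 (p, p) = \sum_d F d 0 (p, p).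
  by rewrite !big_bool.
rewrite /scomm evD.
under eq_bigr => d _ do rewrite evD.
transitivity (\sum_(d : bool) \sum_(e : bool) \sum_(k <- zball M) \sum_(b : bool)
    if (d == p (+) b) && (e == p (+) b)
    then shiftp (- k) (pairing x y k p b) - (-1) ^+ (d && e) *: pairing x y k b p else 0).
  apply: eq_bigr => d _; apply: eq_bigr => e _.
  transitivity ((SD_part d x * SD_part e y) 0 (p, p) - (-1) ^+ (d && e) *:
     (SD_part e y * SD_part d x) 0 (p, p)).
    by case: (d && e); rewrite ?expr0 ?expr1 ?mul1r ?mulN1r ?scale1r ?scaleN1r.
  rewrite !SD_part_mul0 [X in _ - _ *: X]fsum_opp.
  rewrite !(fsumZ (N := M)) => [|k kM|k kM].
  - rewrite scaler_sumr -sumrB; apply: eq_bigr => k _.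
    rewrite scaler_sumr -sumrB; apply: eq_bigr => b _.
    rewrite [(e == _) && _]andbC; case: ifP => _; last by rewrite scaler0 subr0.
    by rewrite /pairing shiftpM shiftp_shiftp addNr shiftp0z !opprK [X in _ = _ - _ *: X]mulrC.
  - by rewrite big1// => b _; rewrite xM// shiftp0 mul0r if_same.
  - by rewrite big1// => b _; rewrite opprK xM// mulr0 if_same.
rewrite (fsumZ (N := M)) => [|k kM]; last first.
  by rewrite big1// => b _; rewrite /pairing !xM// !mul0r shiftp0 scaler0 subr0.
under eq_bigr => d _ do rewrite exchange_big /=.
rewrite exchange_big; apply: eq_bigr => k _ /=.
under eq_bigr => d _ do rewrite exchange_big /=.
rewrite exchange_big; apply: eq_bigr => b _ /=.
by rewrite !big_bool /=; case: (p (+) b); rewrite /= ?addr0 ?add0r.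
Qed.
End Phi.

(** * Spanning elements *)

Section Span.
Variable K : fieldType.

Definition SD_elem (k : int) (g : {poly K}) (a : mindex) : SD K :=
  SD_mono k (fun b => if b == a then g else 0).

Lemma fps_expD_elem a n : fps_expD (SD_elem 0 1 a) n = SD_elem 0 (n`!%:R^-1 *: 'X^n) a.
Proof.
have DnE : SD_D K ^+ n = horner_alg (SD_D K) 'X^n by rewrite rmorphXn /= horner_algX.
rewrite /fps_expD DnE SD_horner SD_mono_mul SD_mono_scale.
apply: eq_SD_mono => b; case: a b => -[] [] [[] []];
  by rewrite !big_bool /= ?shiftp0z ?mulr0 ?mul0r ?mulr1 ?addr0 ?add0r ?scaler0.
Qed.

Lemma dtheta_theta : SD_dtheta K * SD_theta K = SD_elem 0 1 M0.
Proof.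
rewrite SD_mono_mul; apply: eq_SD_mono => -[[] []];
  by rewrite /= big_bool /= ?shiftp0 ?shiftp1 ?mulr0 ?mul0r ?mulr1 ?addr0 ?add0r.
Qed.

Lemma theta_dtheta : SD_theta K * SD_dtheta K = SD_elem 0 1 M1.
Proof.
rewrite SD_mono_mul; apply: eq_SD_mono => -[[] []];
  by rewrite /= big_bool /= ?shiftp0 ?shiftp1 ?mulr0 ?mul0r ?mulr1 ?addr0 ?add0r.
Qed.

Lemma SD_mono_elems k (F : mindex -> {poly K}) :
  SD_mono k F = SD_elem k (F M0) M0 + (SD_elem k (F M1) M1
    + (SD_elem k (F Mp) Mp + SD_elem k (F Mm) Mm)).
Proof.
rewrite !SD_mono_add; apply: eq_SD_mono => -[[] []];
  by rewrite /= ?addr0 ?add0r.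
Qed.

(** A property that is stable under linear combinations can be checked on C and on
    the elements t^k D^n M_a. *)
Lemma SDhat_linear_ind (P : SDhat K -> Prop) :
  (forall c x y, P x -> P y -> P (c *: x + y)) -> P (ext_c (SD K)) ->
  (forall k n a, P (ext_in (SD_elem k 'X^n a))) -> forall x, P x.
Proof.
move=> P_lin P_c P_elem.
have P0 : P 0 by rewrite -(addNr (ext_c (SD K))) -scaleN1r; apply: P_lin.
have P_inD y z : P (ext_in y) -> P (ext_in z) -> P (ext_in (y + z)).
  move=> Py Pz; rewrite (_ : ext_in _ = 1 *: ext_in y + ext_in z); first exact: P_lin.
  by apply: injective_projections => /=; rewrite ?scale1r ?scaler0 ?addr0.
have P_mono k a g : P (ext_in (SD_elem k g a)).
  elim/poly_linear_ind: g => [|c g h IHg IHh|n]; last exact: P_elem.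
    rewrite (_ : ext_in _ = 0) //; apply: injective_projections => //=.
    by rewrite -(SD_mono0 K k); apply: eq_SD_mono => b; rewrite if_same.
  rewrite (_ : ext_in _ = c *: ext_in (SD_elem k g a) + ext_in (SD_elem k h a)).
    exact: P_lin.
  apply: injective_projections => /=; last by rewrite scaler0 addr0.
  rewrite SD_mono_scale SD_mono_add; apply: eq_SD_mono => b.
  by case: eqP; rewrite // scaler0 addr0.
move=> [x c]; rewrite (_ : (x, c) = c *: ext_c (SD K) + ext_in x); last first.
  by apply: injective_projections => /=; rewrite ?scaler0 ?add0r // addr0 /GRing.scale /= mulr1.
apply: P_lin => //; have [r ->] := SD_sum_mono x.
elim: r => [|k r IHr]; first by rewrite big_nil.
by rewrite big_cons SD_mono_elems; do 4![apply: (P_inD) => //].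
Qed.
End Span.

(** * The lift of phi to the central extensions *)

Section Phihat.
Variables (K : fieldType) (s : K) (q : nat -> K).
Hypothesis K0 : [pchar K] =i pred0.
Hypothesis qE : fps_mul q (fps_expm1 1) = fps_expm1 s.
Implicit Types x y : SD K.

(** The map that sends e^(xD) M_0 to -q(x), e^(xD) M_1 to q(x), and vanishes on the
    other components of the principal gradation. *)
Definition correction x : K^o := egf_eval q (x 0 M1 - x 0 M0).

Lemma correction_linear : linear correction.
Proof.
move=> c x y; rewrite /correction !SDDE !SDZE opprD addrACA -scalerBr.
by rewrite linearP.
Qed.
HB.instance Definition _ := GRing.isLinear.Build K (SD K) K^o _ correction correction_linear.

(** The two central extensions differ, along [phi s], by the coboundary of
    [correction]. *)
Lemma correction_scomm x y :
  correction (scomm (@SD_part K) x y) = cocycle s x y - cocycle 0 x y.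
Proof.
have [M xM] := SD_bound x; rewrite /correction /M0 /M1 !scomm_diag.
have p0 k p b : (M < `|k|)%N -> pairing x y k p b = 0.
  by move=> kM; rewrite /pairing xM// mul0r.
have st0 z k p b : (M < `|k|)%N -> stair k (fun w => (pairing x y k p b).[z + w]) = 0.
  by move=> kM; apply: fsbig1 => m _; rewrite p0// horner0 mulr0.
rewrite /cocycle !(fsumZ (N := M)) => [|k kM|k kM|k kM|k kM]; first last.
- by rewrite big1// => b _; rewrite !p0// shiftp0 scaler0 subr0.
- by rewrite big1// => b _; rewrite !p0// shiftp0 scaler0 subr0.
- by rewrite big1// => p _; rewrite big1// => b _; rewrite st0// mulr0.
- by rewrite big1// => p _; rewrite big1// => b _; rewrite st0// mulr0.
rewrite -!sumrB raddf_sum; apply: eq_bigr => k _ /=.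
have stE p b : stair k (fun z => (pairing x y k p b).[s + z]) -
    stair k (fun z => (pairing x y k p b).[0 + z]) =
    egf_eval q (pairing x y k p b) - egf_eval q (shiftp (- k) (pairing x y k p b)).
  rewrite -raddfB /= (egf_eval_stair K0 _ _ qE); congr (_ - stair _ _).
  by apply/funext => z; rewrite add0r.
rewrite !big_bool /= !expr0 !expr1 !scale1r !scaleN1r !mul1r !mulN1r !opprK.
rewrite !(raddfB, raddfD, raddfN) /=.
have {}stE p b := canRL (subrK _) (stE p b).
by rewrite !stE; ring.
Qed.

Definition phihat (x : SDhat K) : glhat K := (phi s x.1, x.2 + correction x.1).

Lemma phihat_linear : linear phihat.
Proof.
move=> c x y; rewrite /phihat /= !linearP /=; congr pair.
by rewrite /GRing.scale /= {1}/GRing.scale /= mulrDr addrACA.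
Qed.

Lemma phihat_superhom :
  lie_superhom (@SDhat_part K) (@SDhat_br K) (@glhat_part K) (@glhat_br K) phihat.
Proof.
split; first exact: phihat_linear.
  move=> e [x c] [xE cE]; rewrite /glhat_part /ext_part /phihat /=; congr pair.
    by rewrite -phi_part xE.
  case: e xE cE => // xE <-.
  by rewrite add0r -xE /correction /= /coef_part /= subrr raddf0.
move=> x y; rewrite /SDhat_br /glhat_br /ext_br /phihat /=; congr pair.
  exact: phi_scomm.
by rewrite alpha_phi correction_scomm Psi_cocycle addrC subrK.
Qed.

Lemma egf_eval_basis n : egf_eval q (n`!%:R^-1 *: 'X^n) = q n.
Proof.
by rewrite linearZ /= egf_evalXn; apply: mulKf; apply: fact_neq0.
Qed.

Lemma phihat_specP : phihat_spec s phihat.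
Proof.
split.
- exact: phihat_linear.
- move=> d [x c] d0 [xd cd]; rewrite /phihat /ext_in /=; congr pair.
  have -> : c = 0 by apply/eqP; apply: contraNT d0 => /cd ->.
  rewrite add0r /correction.
  have xd0 p : x 0 (p, p) = 0.
    by apply/eqP; apply: contraNT d0 => /xd /=; rewrite /wt2 /= mulr0 add0r subrr => <-.
  by rewrite /M1 /M0 !xd0 subrr raddf0.
- exists q; split=> // n /=.
    rewrite dtheta_theta fps_expD_elem /phihat /ext_in /ext_c; apply: injective_projections => /=.
      by rewrite scaler0 subr0.
    by rewrite !add0r [in RHS]/GRing.scale /= mulr1 /correction /= sub0r raddfN /= egf_eval_basis.
  rewrite theta_dtheta fps_expD_elem /phihat /ext_in /ext_c; apply: injective_projections => /=.
    by rewrite scaler0 addr0.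
  by rewrite !add0r [in RHS]/GRing.scale /= mulr1 /correction /= subr0 egf_eval_basis.
- by rewrite /phihat /ext_c /= !raddf0 addr0.
Qed.
End Phihat.

(** * Uniqueness *)

Section Uniqueness.
Variables (K : fieldType) (s : K).
Hypothesis K0 : [pchar K] =i pred0.

(** Linear maps that satisfy the specification agree on the spanning elements: in
    nonzero degree it prescribes them outright, and in degree zero the coefficient
    of x^n in e^(xD) M_a is D^n M_a / n!. *)
Lemma phihat_spec_inj (f g : SDhat K -> glhat K) :
  phihat_spec s f -> phihat_spec s g -> f = g.
Proof.
move=> [f_lin f_deg [q1 [q1E f0 f1]] f_c] [g_lin g_deg [q2 [q2E g0 g1]] g_c].
have q12 : q1 = q2.
  apply: (@fps_mulI _ (fps_expm1 1)); rewrite ?q1E ?q2E ?fps_expm1_0 ?fps_expm1_1//.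
  exact: oner_neq0.
subst q2; pose eqfg (x : SDhat K) := f x = g x.
have eqfg_lin c x y : eqfg x -> eqfg y -> eqfg (c *: x + y).
  by rewrite /eqfg f_lin g_lin => -> ->.
apply/funext; apply: (SDhat_linear_ind eqfg_lin); first by rewrite /eqfg f_c g_c.
move=> k n a; rewrite /eqfg.
have [ka|ka] := eqVneq (2 * k + wt2 a) 0; last first.
  have degka : @SDhat_deg K (2 * k + wt2 a) (ext_in (SD_elem k 'X^n a)).
    split=> [l b /=|]; last by rewrite eqxx.
    case: (eqVneq l k) => [->|_] /=; last by rewrite eqxx.
    by case: (eqVneq b a) => [->|_] //; rewrite eqxx.
  by rewrite (f_deg _ _ ka degka) (g_deg _ _ ka degka).
have k0 : k = 0 by move: ka; case: (a) => -[] []; rewrite /wt2 /=; lia.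
have aE : a = M0 \/ a = M1.
  by move: ka; case: (a) => -[] []; rewrite /wt2 /=; [right|lia|lia|left].
have -> : ext_in (SD_elem k 'X^n a) =
    n`!%:R *: ext_in (fps_expD (SD_elem 0 1 a) n) + 0 :> SDhat K.
  rewrite addr0 fps_expD_elem k0; apply: injective_projections => /=; last by rewrite scaler0.
  rewrite SD_mono_scale; apply: eq_SD_mono => b.
  by case: eqP; rewrite ?scaler0 // scalerA divff ?scale1r ?fact_neq0.
apply: eqfg_lin; rewrite /eqfg; last first.
  by rewrite -[0](addNr (ext_c (SD K))) -scaleN1r f_lin g_lin f_c g_c.
by case: aE => ->; rewrite -?dtheta_theta -?theta_dtheta ?f0 ?g0 ?f1 ?g1.
Qed.
End Uniqueness.

Theorem proposition6p4 (R : realType) (s : R[i]) :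
  exists phihat : SDhat R[i] -> glhat R[i],
    unique (phihat_spec s) phihat /\
    lie_superhom (@SDhat_part R[i]) (@SDhat_br R[i])
                 (@glhat_part R[i]) (@glhat_br R[i]) phihat.
Proof.
have K0 : [pchar R[i]] =i pred0 by exact: pchar_num.
pose q := fps_div (fps_expm1 s) (fps_expm1 1).
have qE : fps_mul q (fps_expm1 1) = fps_expm1 s.
  by apply: fps_divK; rewrite ?fps_expm1_0 ?fps_expm1_1 ?oner_eq0.
exists (phihat s q); split; last exact: phihat_superhom.
by split=> [|f]; [|apply: phihat_spec_inj => //]; exact: phihat_specP.
Qed.
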